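(* Let $G=(V,E)$ be a rooted digraph, and let $V_1,\ldots,V_q$ be the relevant subsets of $G$. Let $W$ be the subset of $\operatorname{Sp}[V]$ comprised of the vectors $w$ for which $\mathbb{A}_G(w)$ is nonempty. Then $$W=\bigcup_{i=1}^q \operatorname{Sp}(V_i).$$
   Context: Digraphs are finite and simple: no self-loops and at most one edge for each ordered pair of vertices; $V=\{1,\ldots,n\}$. An edge from $i$ to $j$ is written $i\to j$. A vertex $r$ is a root of $G$ if for every $i\in V$ there is a (directed) path from $i$ to $r$; $G$ is rooted if it contains a root (a one-vertex graph is rooted by convention). $V_r\subset V$ denotes the set of all roots. $G$ is strongly connected if for every ordered pair $(i,j)$ of vertices there is a path from $i$ to $j$ (a one-vertex graph is strongly connected). The subgraph induced by $V'\subset V$ has vertex set $V'$ and all edges of $G$ with both endpoints in $V'$. Relevant subset: a subset $V'\subset V$ of a rooted digraph $G$ is relevant if (a) $V'\subset V_r$, and (b) the subgraph of $G$ induced by $V'$ is strongly connected. With $e_1,\ldots,e_n$ the standard basis of $\mathbb{R}^n$ and $V'\subset V$, $\operatorname{Sp}[V']=\{\sum_{i\in V'}\alpha_ie_i\mid \alpha_i\ge 0,\ \sum_{i\in V'}\alpha_i=1\}$ and $\operatorname{Sp}(V')=\{\sum_{i\in V'}\alpha_ie_i\mid \alpha_i> 0,\ \sum_{i\in V'}\alpha_i=1\}$. An infinitesimal stochastic matrix (ISM) is a real square matrix whose off-diagonal entries are non-negative and whose rows each sum to zero. $\mathbb{A}_G$ is the set of $n\times n$ ISMs $A=(a_{ij})$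 such that for $i\ne j$, $a_{ij}=0$ whenever $i\to j$ is not an edge of $G$ (and $a_{ij}\ge0$ if it is). If $G$ has a single vertex, $\mathbb{A}_G=\{0\}$. For $w\in\operatorname{Sp}[V]$, $\mathbb{A}_G(w)$ is the set of $A\in\mathbb{A}_G$ such that $A$ has a simple zero eigenvalue and $A^\top w=0$. *)

(* Defs.v *)
From HB Require Import structures.
From mathcomp Require Import all_boot all_order all_algebra.
From mathcomp Require Import classical_sets reals.
Set Implicit Arguments.
Unset Strict Implicit.
Unset Printing Implicit Defensive.

Import Order.TTheory GRing.Theory Num.Theory.

Local Open Scope ring_scope.
Local Open Scope classical_set_scope.

Record digraph (T : finType) := Digraph {
  edge :> rel T;
  edge_irrefl : irreflexive edge
}.

Section Digraphs.
Variables (T : finType) (G : digraph T).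

(* [connect G i j] holds iff there is a directed path from i to j; the path of
   length zero is allowed, which yields the conventions on one-vertex graphs. *)
Definition is_root (r : T) : bool := [forall i, connect G i r].

Definition rooted : bool := [exists r, is_root r].

Definition root_set : {set T} := finset is_root.

Definition strongly_connected : bool := [forall i, forall j, connect G i j].

Definition induced_subgraph (U : {set T}) : digraph {i : T | i \in U} :=
  @Digraph _ (relpre val G) (fun i => edge_irrefl G (val i)).

End Digraphs.

(* The empty set is not excluded; it is harmless below as [Sp_open R set0] is
   empty. *)
Definition relevant (T : finType) (G : digraph T) (U : {set T}) : bool :=
  (U \subset root_set G) && strongly_connected (induced_subgraph G U).

Section Matrices.
Variables (R : realType) (n : nat).

Definition std_basis (i : 'I_n) : 'cV[R]_n := delta_mx i 0.

Definition Sp_closed (U : {set 'I_n}) : set 'cV[R]_n :=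
  [set w | exists alpha : 'I_n -> R,
     [/\ forall i, i \in U -> 0 <= alpha i,
         \sum_(i in U) alpha i = 1
       & w = \sum_(i in U) alpha i *: std_basis i]].

Definition Sp_open (U : {set 'I_n}) : set 'cV[R]_n :=
  [set w | exists alpha : 'I_n -> R,
     [/\ forall i, i \in U -> 0 < alpha i,
         \sum_(i in U) alpha i = 1
       & w = \sum_(i in U) alpha i *: std_basis i]].

(* ISM: infinitesimal stochastic matrix. *)
Definition ISM (A : 'M[R]_n) : Prop :=
  (forall i j, i != j -> 0 <= A i j) /\ (forall i, \sum_j A i j = 0).

Definition ISM_of (G : digraph 'I_n) : set 'M[R]_n :=
  [set A | ISM A /\ forall i j, i != j -> ~~ G i j -> A i j = 0].

(* Simplicity is algebraic: a is a root of multiplicity one of the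
   characteristic polynomial. *)
Definition simple_eigenvalue (A : 'M[R]_n) (a : R) : Prop :=
  mup a (char_poly A) = 1%N.

Definition ISM_at (G : digraph 'I_n) (w : 'cV[R]_n) : set 'M[R]_n :=
  [set A | [/\ ISM_of G A, simple_eigenvalue A 0 & A^T *m w = 0]].

Definition feasible_set (G : digraph 'I_n) : set 'cV[R]_n :=
  [set w | Sp_closed [set: 'I_n]%SET w /\ ISM_at G w !=set0].

End Matrices.

Arguments Sp_closed R {n} U.
Arguments Sp_open R {n} U.
Arguments feasible_set R {n} G.

(* Main.v *)
Require Import Defs.
From mathcomp Require Import all_boot all_order all_algebra.
From mathcomp Require Import classical_sets reals.
Set Implicit Arguments.
Unset Strict Implicit.
Unset Printing Implicit Defensive.
Import Order.TTheory GRing.Theory Num.Theory.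
Local Open Scope ring_scope.

(* If [A] has a simple zero eigenvalue then [w] spans its left kernel.  The set
   of vertices that a given vertex reaches along positive entries of [A] is
   invariant, so it carries a nonzero left null vector of [A], which must be a
   multiple of [w]: hence every vertex reaches the whole support of [w].

   Conversely, the unit-weight Laplacian of [G] with the arcs leaving [U] deleted
   has a stationary vector [u] that is positive on [U] and zero elsewhere, and
   multiplying row [i] by [u i / w i] turns [u] into [w]. *)

(** * Multiplicity of the eigenvalue zero against the dimension of the kernel *)

Section ZeroEigenvalue.
Variables (F : fieldType) (n : nat).
Implicit Types (A : 'M[F]_n) (v w : 'rV[F]_n).

(* With [L := invmx (col_ebase A)], the rows of [L *m A] beyond [\rank A]
   vanish, so those rows of [L *m ('X%:M - A)] are multiples of ['X]. *)
Lemma Xn_dvd_char_poly A : 'X^(n - \rank A) %| char_poly A.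
Proof.
set r := \rank A; pose L := invmx (col_ebase A).
have LA : L *m A = pid_mx r *m row_ebase A.
  by rewrite -{1}(mulmx_ebase A) -mulmxA mulKmx ?col_ebase_unit.
have detL : \det L != 0.
  by rewrite -unitfE -unitmxE unitmx_inv col_ebase_unit.
pose d : 'rV[{poly F}]_n := \row_i (if (i < r)%N then 1 else 'X).
pose M := \matrix_(i, j)
  (if (i < r)%N then ('X * (L i j)%:P - ((L *m A) i j)%:P) else (L i j)%:P).
have LXA : map_mx polyC L *m char_poly_mx A = diag_mx d *m M.
  rewrite /char_poly_mx mulmxBr mul_mx_scalar -map_mxM mul_diag_mx.
  apply/matrixP=> i j; rewrite !mxE /=; case: ltnP => [_|le_r_i].
    by rewrite mul1r.
  suff ->: \sum_k L i k * A k j = 0 by rewrite subr0.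
  have := congr1 (fun B : 'M_n => B i j) LA; rewrite !mxE => ->.
  by rewrite big1 // => k _; rewrite mxE ltnNge le_r_i andbF mul0r.
have /(congr1 determinant) := LXA.
rewrite !det_mulmx det_map_mx det_diag -/(char_poly A) => e.
rewrite -(@dvdpZr _ (\det L)) // -mul_polyC e; apply: dvdp_mulr.
under eq_bigr do rewrite mxE.
rewrite -(big_mkord xpredT (fun i => if (i < r)%N then 1 else 'X)).
rewrite (@big_cat_nat _ _ _ r) ?rank_leq_row //=.
rewrite big_nat big1 ?mul1r => [|i /andP[_ ->] //].
rewrite big_nat (eq_bigr (fun _ => 'X)) -?big_nat ?prodr_const_nat //.
by move=> i /andP[le_r_i _]; rewrite ltnNge le_r_i.
Qed.

(** The geometric multiplicity [n - \rank A] is at most the algebraic one, so the left kernel has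
    dimension at most 1 and [w] fills it. *)
Lemma simple_left_kernel A v w :
  mup 0 (char_poly A) = 1%N -> w != 0 -> w *m A = 0 -> v *m A = 0 ->
  exists c, v = c *: w.
Proof.
move=> simpleA w_neq0 wA vA; apply/sub_rVP.
have le_ker : (\rank (kermx A) <= 1)%N.
  rewrite mxrank_ker -simpleA mup_geq ?polyC0 ?subr0 ?Xn_dvd_char_poly //.
  exact/monic_neq0/char_poly_monic.
have w_ker : (w <= kermx A)%MS by apply/sub_kermxP.
apply: (submx_trans (B := kermx A)); first exact/sub_kermxP.
by rewrite -(mxrank_leqif_sup w_ker) eqn_leq mxrankS // rank_rV w_neq0.
Qed.

(* As [w *m A = 0] and [A *m u = 0],
   ['X - A] times ['X + u *m w] equals ['X * ('X - (A - u *m w))];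
   the nonsingular [A - u *m w] contributes no factor ['X]. *)
Lemma simple_zero A (u : 'cV[F]_n) w :
    w *m A = 0 -> A *m u = 0 -> w *m u = 1%:M ->
    (forall v : 'cV[F]_n, A *m v = 0 -> exists c, v = c *: u) ->
  mup 0 (char_poly A) = 1%N.
Proof.
move=> wA Au wu kerA.
have charN0 (B : 'M[F]_n) : char_poly B != 0.
  exact/monic_neq0/char_poly_monic.
have X_ge1 : 'X %| char_poly A.
  rewrite -[in 'X](subr0 'X) -polyC0 dvdp_XsubCl -eigenvalue_root_char.
  apply/eigenvalueP; exists w; first by rewrite wA scale0r.
  by apply: contra_eq_neq wu => ->; rewrite mul0mx eq_sym -scalemx1 scale1r oner_eq0.
pose M := A - u *m w.
(* Since [w *m M = - w], a right null vector of [M] is annihilated by [w], hence null for [A] and of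
   the form [c *: u]; then [w *m u = 1%:M] forces [c = 0]. *)
have detM : \det M != 0.
  rewrite -det_tr; apply/det0P => -[v v_neq0 /(congr1 trmx)].
  rewrite trmx_mul trmxK trmx0 => Mv; case/eqP: v_neq0.
  have wM : w *m M = - w by rewrite mulmxBr wA mulmxA wu mul1mx sub0r.
  have wv : w *m v^T = 0.
    by apply/eqP; rewrite -oppr_eq0 -mulNmx -wM -mulmxA Mv mulmx0.
  have /kerA [c def_v] : A *m v^T = 0.
    by move: Mv; rewrite mulmxBl -mulmxA wv mulmx0 subr0.
  have c0 : c = 0.
    move: wv; rewrite def_v -scalemxAr wu scalemx1 => /matrixP/(_ 0 0).
    by rewrite !mxE.
  by rewrite -[v]trmxK def_v c0 scale0r trmx0.
have eM : char_poly A * char_poly (- (u *m w)) = 'X^n * char_poly M.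
  rewrite -det_scalar -!det_mulmx; congr determinant.
  rewrite /char_poly_mx mulmxBl !mulmxBr -!map_mxM mulmxN mulmxA Au mul0mx oppr0.
  rewrite map_mx0 subr0 /M map_mxD map_mxN !mul_scalar_mx mul_mx_scalar.
  by rewrite scalerN opprK scalerBr opprB addrA.
apply/eqP; rewrite eqn_leq mup_leq // mup_geq // polyC0 subr0 expr1 X_ge1 andbT.
apply/negP => X2.
(* As [u *m w] has rank at most 1, its factor contributes ['X^(n.-1)]. Together with ['X^2] from [A]
   this exceeds ['X^n] by one, so ['X] would divide [char_poly M]. *)
have rk1 : (n.-1 <= n - \rank (- (u *m w)))%N.
  rewrite -subn1 leq_sub2l // mxrank_opp (leq_trans (mxrankM_maxl _ _)) //.
  exact: rank_leq_col.
have n_gt0 : (0 < n)%N.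
  case: (posnP n) => // n0; have := congr1 (fun B : 'M_1 => B 0 0) wu.
  rewrite mxE [RHS]mxE big1 => [/eqP|[i]]; first by rewrite eq_sym oner_eq0.
  by move=> lt_i; have := lt_i; rewrite [X in (_ < X)%N]n0.
have := dvdp_mul X2 (dvdp_trans (dvdp_exp2l _ rk1) (Xn_dvd_char_poly _)).
rewrite eM -exprD addSnnS prednK // add1n exprSr.
rewrite dvdp_mul2l ?expf_neq0 ?polyX_eq0 //.
rewrite -[in 'X](subr0 'X) -polyC0 dvdp_XsubCl /root horner_coef0 char_poly_det.
by rewrite mulf_eq0 signr_eq0 (negbTE detM).
Qed.
End ZeroEigenvalue.

(** * Reachability and null vectors of infinitesimal stochastic matrices *)

Lemma connect_stable (T : finType) (e : rel T) (P : T -> Prop) (x y : T) :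
  (forall a b, e a b -> P a -> P b) -> connect e x y -> P x -> P y.
Proof.
move=> eP /connectP[p + ->]; elim: p x => //= z p IHp x /andP[exz pz] Px.
exact/IHp/(eP x).
Qed.

Section InfinitesimalStochastic.
Variables (R : realType) (n : nat).
Implicit Types (A : 'M[R]_n) (v w : 'rV[R]_n) (C U : {set 'I_n}).

Definition arc A : rel 'I_n := [rel i j | (i != j) && (0 < A i j)].

(** Replacing the rows outside [C] by those of minus the identity gives a [B] that kills the
    indicator of [C], hence is singular. Its columns outside [C] force a left null vector to vanish
    there, and on such vectors [B] and [A] agree. *)
Lemma invariant_left_kernel A C k :
    k \in C -> (forall i, i \in C -> \sum_j A i j = 0) ->
    (forall i j, i \in C -> j \notin C -> A i j = 0) ->
  exists2 v : 'rV_n, v != 0 /\ v *m A = 0 & forall j, j \notin C -> v 0 j = 0.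
Proof.
move=> Ck sumA A0.
pose B := \matrix_(i, j) (if i \in C then A i j else - (i == j)%:R).
have : \det B == 0.
  rewrite -det_tr; apply/det0P; exists (\row_j (j \in C)%:R).
    by apply/rV0Pn; exists k; rewrite mxE Ck oner_neq0.
  apply/rowP => i; rewrite !mxE; case: (boolP (i \in C)) => Ci.
    rewrite -[RHS](sumA i Ci); apply: eq_bigr => j _; rewrite !mxE Ci.
    by case: (boolP (j \in C)) => Cj; rewrite ?mul1r // A0 ?mulr0.
  rewrite big1 // => j _; rewrite !mxE (negbTE Ci).
  by case: eqVneq => [<-|]; rewrite ?(negbTE Ci) ?mul0r ?oppr0 ?mulr0.
case/det0P => v v_neq0 vB.
have v0 j : j \notin C -> v 0 j = 0.
  move=> Cj; move/rowP/(_ j): vB; rewrite !mxE (bigD1 j) //= mxE (negbTE Cj).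
  rewrite eqxx mulrN1 big1 ?addr0 => [/eqP|i ij]; first by rewrite oppr_eq0 => /eqP.
  rewrite mxE (negbTE ij) oppr0; case: ifP => Ci; last by rewrite mulr0.
  by rewrite A0 ?mulr0.
exists v => //; split=> //; rewrite -vB; apply/rowP => j; rewrite !mxE; apply: eq_bigr => i _.
by rewrite mxE; case: (boolP (i \in C)) => // Ci; rewrite v0 ?mul0r.
Qed.

(** If [w 0 j] were zero, column [j] of [w *m A = 0] would be a sum of nonnegative terms, among them
    the positive [w 0 i * A i j]. *)
Lemma support_closed A w i j :
  ISM A -> (forall k, 0 <= w 0 k) -> w *m A = 0 -> arc A i j ->
  0 < w 0 i -> 0 < w 0 j.
Proof.
move=> [A_ge0 _] w_ge0 wA /andP[neq_ij Aij] wi; rewrite lt0r w_ge0 andbT.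
apply: contraTneq isT => wj0.
have wA_ge0 k : true -> 0 <= w 0 k * A k j.
  by case: (eqVneq k j) => [->|kj] _; rewrite ?wj0 ?mul0r // mulr_ge0 ?A_ge0.
have := psumr_eq0P wA_ge0; move/rowP/(_ j): wA; rewrite !mxE => -> /(_ erefl i isT).
by move/eqP; rewrite mulf_eq0 !gt_eqF.
Qed.

(* [d := `|v| *m A] is nonnegative by the triangle inequality, and its entries
   sum to zero because the rows of [A] do. *)
Lemma norm_left_kernel A v :
  ISM A -> v *m A = 0 -> map_mx Num.norm v *m A = 0.
Proof.
move=> [A_ge0 sumA] vA; set d := _ *m A.
have d_ge0 j : true -> 0 <= d 0 j.
  move=> _; rewrite mxE (bigD1 j) //= mxE.
  have A_le0 : A j j <= 0.
    have := sumA j; rewrite (bigD1 j) //= => /eqP; rewrite addr_eq0 => /eqP ->.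
    by rewrite oppr_le0 sumr_ge0 // => k kj; rewrite A_ge0 // eq_sym.
  move/rowP/(_ j): vA; rewrite !mxE (bigD1 j) //= => /eqP.
  rewrite addr_eq0 => /eqP/(congr1 Num.norm); rewrite normrN normrM (ler0_norm A_le0).
  rewrite mulrN => /eqP; rewrite eqr_oppLR => /eqP ->; rewrite addrC subr_ge0.
  apply: (le_trans (ler_norm_sum _ _ _)); apply: ler_sum => i ij.
  by rewrite normrM mxE (ger0_norm (A_ge0 _ _ ij)).
have sum_d : \sum_j d 0 j = 0.
  under eq_bigr do rewrite mxE.
  rewrite exchange_big big1 // => i _.
  by rewrite -mulr_sumr sumA mulr0.
by apply/rowP => j; rewrite (psumr_eq0P d_ge0 sum_d) ?mxE.
Qed.

(** Row [x] of [A *m v = 0] balances weighted differences between [v x 0] and the other values. At a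
    maximum they all have one sign, so the maximum passes along every arc, from a maximal vertex to
    [k]. *)
Lemma maximum_principle A (v : 'cV_n) k :
    ISM A -> A *m v = 0 -> (forall i, connect (arc A) i k) ->
  forall i, v i 0 <= v k 0.
Proof.
move=> [A_ge0 sumA] Av k_reach.
case: (@arg_maxP _ _ _ k xpredT (fun i => v i 0)) => // m _ max_m i.
suff -> : v k 0 = v m 0 by apply: max_m.
apply: (connect_stable (P := fun x => v x 0 = v m 0)) (k_reach m) (erefl _).
move=> x y /andP[_ Axy] vx.
have ge0 j : true -> 0 <= A x j * (v m 0 - v j 0).
  move=> _; case: (eqVneq x j) => [<-|xj]; first by rewrite vx subrr mulr0.
  by rewrite mulr_ge0 ?A_ge0 // subr_ge0; apply: max_m.
have sum0 : \sum_j A x j * (v m 0 - v j 0) = 0.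
  under eq_bigr do rewrite mulrBr.
  rewrite sumrB -mulr_suml sumA mul0r sub0r; move/colP/(_ x): Av.
  by rewrite !mxE => ->; rewrite oppr0.
move/eqP: (psumr_eq0P ge0 sum0 (i := y) isT).
by rewrite mulf_eq0 gt_eqF // subr_eq0 => /eqP.
Qed.

(** The maximum principle for [v] and for [- v] puts both extrema at [k]. *)
Lemma kernel_const A (v : 'cV_n) k :
    ISM A -> A *m v = 0 -> (forall i, connect (arc A) i k) ->
  v = v k 0 *: const_mx 1.
Proof.
move=> ismA Av k_reach; apply/colP => i; rewrite !mxE mulr1; apply/le_anti.
have ANv : A *m - v = 0 by rewrite mulmxN Av oppr0.
rewrite (maximum_principle ismA Av) //=.
by have := maximum_principle ismA ANv k_reach i; rewrite !mxE lerN2.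
Qed.

(** Minus the usual out-degree Laplacian; a loop [e i i] cancels on the diagonal. *)
Definition laplacian (e : rel 'I_n) : 'M[R]_n :=
  \matrix_(i, j) ((e i j)%:R - (i == j)%:R * \sum_k (e i k)%:R).

Lemma laplacian_off e i j : i != j -> laplacian e i j = (e i j)%:R.
Proof. by move=> /negbTE ij; rewrite mxE ij mul0r subr0. Qed.

Lemma laplacian_ISM e : ISM (laplacian e).
Proof.
split=> [i j ij|i]; first by rewrite laplacian_off ?ler0n.
under eq_bigr do rewrite mxE.
rewrite sumrB -mulr_suml [X in _ - X * _](bigD1 i) //= eqxx.
rewrite [X in (1 + X) * _]big1 ?addr0 ?mul1r ?subrr // => j.
by rewrite eq_sym => /negbTE ->.
Qed.

(** * The two inclusions, for row vectors *)

Lemma support_relevant (G : digraph 'I_n) A w :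
    ISM_of G A -> simple_eigenvalue A 0 -> (forall i, 0 <= w 0 i) -> w != 0 ->
    w *m A = 0 ->
  relevant G [set i | 0 < w 0 i].
Proof.
move=> [ismA A_G] simpleA w_ge0 w_neq0 wA; set U := [set i | _].
have arc_G i j : arc A i j -> G i j.
  move=> /andP[ij]; apply: contraTT => Gij; by rewrite A_G ?ltxx.
have [A_ge0 sumA] := ismA.
have reach k i : i \in U -> connect (arc A) k i.
  rewrite inE => wi; pose C := [set j | connect (arc A) k j].
  have [||i1 j|v [v_neq0 vA] v_C] := @invariant_left_kernel A C k.
  - by rewrite inE connect0.
  - by [].
  - rewrite !inE => k_i1; apply: contraNeq => A_neq0.
    have [<- //|ij] := eqVneq i1 j; apply: connect_trans k_i1 (connect1 _).
    by rewrite /arc /= ij lt0r A_neq0 A_ge0.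
  (* Here [c] is nonzero, so [w] has the same support as [v], which lies in [C]. *)
  have [c def_v] := simple_left_kernel simpleA w_neq0 wA vA.
  suff: i \in C by rewrite inE.
  apply: contraLR wi => /v_C; rewrite def_v mxE => /eqP.
  rewrite mulf_eq0 => /orP[/eqP c0|/eqP ->]; last by rewrite ltxx.
  by rewrite def_v c0 scale0r eqxx in v_neq0.
apply/andP; split.
  apply/fintype.subsetP => i /reach Ui; rewrite inE; apply/forallP => k.
  by apply: connect_sub (Ui k) => x y /arc_G/connect1.
apply/forallP => -[i Ui]; apply/forallP => -[j Uj].
(* Vertices of the induced subgraph carry membership proofs, so the invariant bundles [y \in U] with
   a path inside [U]; [support_closed] propagates it. *)
pose P y := exists Uy : y \in U,
  connect (induced_subgraph G U) (exist _ i Ui) (exist _ y Uy).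
have [||Uj' ij] := @connect_stable _ (arc A) P i j _ (reach i j Uj).
- move=> x y xy [Ux ix].
  have Uy : y \in U.
    by have := Ux; rewrite !inE => /(support_closed ismA w_ge0 wA xy).
  by exists Uy; apply: connect_trans ix (connect1 _); apply: arc_G.
- by exists Ui; apply: connect0.
by rewrite (bool_irrelevance Uj Uj').
Qed.

Lemma relevant_feasible (G : digraph 'I_n) U w :
    relevant G U -> (forall i, i \in U -> 0 < w 0 i) ->
    (forall i, i \notin U -> w 0 i = 0) -> \sum_i w 0 i = 1 ->
  exists A, [/\ ISM_of G A, simple_eigenvalue A 0 & w *m A = 0].
Proof.
move=> /andP[/fintype.subsetP U_root scU] w_gt0 w_0 sum_w.
(* The empty set passes [relevant]; the total mass 1 of [w] excludes it. *)
have [k Uk] : exists k, k \in U.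
  apply/set0Pn; apply: contra_eq_neq sum_w => U0.
  by rewrite big1 ?(eq_sym 0) ?oner_eq0 // => i _; rewrite w_0 // U0 inE.
pose e : rel 'I_n := [rel i j | G i j && ((i \in U) ==> (j \in U))].
pose B := laplacian e.
have ismB : ISM B := laplacian_ISM e.
have arcB i j : e i j -> arc B i j.
  move=> eij; have ij : i != j.
    by apply: contraTneq eij => ->; rewrite /e /= edge_irrefl.
  by rewrite /arc /= ij laplacian_off // eij ltr01.
have U_reach i j : i \in U -> j \in U -> connect (arc B) i j.
  move=> Ui Uj; have /forallP/(_ (exist _ i Ui))/forallP/(_ (exist _ j Uj)) := scU.
  move=> /connect_stable - /(_ (fun y => connect (arc B) i (val y))); apply=> //.
  move=> [x Ux] [y Uy] /= Gxy ix; apply: connect_trans ix (connect1 _).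
  by apply: arcB; apply/andP; split=> //; apply/implyP.
(* Arcs starting outside [U] survive in [e]; once a path of [G] to [k] enters [U], strong
   connectivity finishes it inside [U]. *)
have k_reach i : connect (arc B) i k.
  have : k \in root_set G := U_root k Uk.
  rewrite inE => /forallP/(_ i)/connectP[p].
  elim: p i => [|j p IHp] i /=; first by move=> _ ->; apply: connect0.
  move=> /andP[Gij pj] k_last; have jk := IHp j pj k_last.
  have [Ui|Ui] := boolP (i \in U); first exact: U_reach.
  by apply: connect_trans (connect1 _) jk; apply: arcB; apply/andP; split; rewrite // (negbTE Ui).
have [||i j Ui Uj|v [v_neq0 vB] v_U] := @invariant_left_kernel B U k.
- exact: Uk.
- by move=> i _; apply: (proj2 ismB).
- rewrite laplacian_off; last by apply: contraNneq Uj => <-.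
  by rewrite /e /= Ui (negbTE Uj) andbF.
pose u := map_mx Num.norm v.
have uB : u *m B = 0 := norm_left_kernel ismB vB.
have u_ge0 i : 0 <= u 0 i by rewrite mxE.
(* Positivity starts at a vertex of [U] where [v] is nonzero and spreads over [U] by
   [support_closed]. *)
have u_gt0 i : i \in U -> 0 < u 0 i.
  move=> Ui; have /rV0Pn[j vj] := v_neq0.
  have Uj : j \in U by apply: contraNT vj => /v_U ->.
  apply: (connect_stable (P := fun x => is_true (0 < u 0 x))) (U_reach j i Uj Ui) _.
    by move=> x y; apply: support_closed.
  by rewrite mxE normr_gt0.
(* Outside [U] both [u] and [w] vanish, so any positive weight serves there; positive weights keep
   every arc of [B] an arc of the rescaled matrix. *)
pose d : 'rV[R]_n := \row_i (if i \in U then u 0 i / w 0 i else 1).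
have d_gt0 i : 0 < d 0 i.
  by rewrite mxE; case: ifP => // Ui; rewrite divr_gt0 ?u_gt0 ?w_gt0.
have wd : w *m diag_mx d = u.
  apply/rowP => i; rewrite mul_mx_diag !mxE; case: ifP => [/w_gt0 wi|/negbT Ui].
    by rewrite mulrC divfK // gt_eqF.
  by rewrite w_0 // v_U // mul0r normr0.
pose A := diag_mx d *m B.
have AE i j : A i j = d 0 i * B i j by rewrite /A mul_diag_mx mxE.
have ismA : ISM A.
  split=> [i j ij|i]; first by rewrite AE mulr_ge0 ?(ltW (d_gt0 _)) ?(proj1 ismB).
  by under eq_bigr do rewrite AE; rewrite -mulr_sumr (proj2 ismB) mulr0.
have wA : w *m A = 0 by rewrite mulmxA wd.
exists A; split=> //.
  by split=> // i j ij Gij; rewrite AE laplacian_off // /e /= (negbTE Gij) mulr0.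
(* The all-ones vector is null because rows sum to zero, and its pairing with [w] is the total mass
   1. *)
apply: (simple_zero (u := const_mx 1) wA).
- apply/colP => i; rewrite mxE [RHS]mxE.
  under eq_bigr do rewrite [const_mx _ _ _]mxE mulr1.
  exact: (proj2 ismA).
- apply/matrixP => a b; rewrite !ord1 mxE [RHS]mxE -[RHS]sum_w.
  by apply: eq_bigr => i _; rewrite [const_mx _ _ _]mxE mulr1.
move=> v' Av'; exists (v' k 0); apply: (kernel_const ismA) => // i.
apply: connect_sub (k_reach i) => x y /andP[xy Bxy]; apply: connect1.
by rewrite /arc /= xy AE mulr_gt0.
Qed.

(** * Coordinate descriptions of the simplices *)

Lemma sum_std_basis U (a : 'I_n -> R) j :
  (\sum_(i in U) a i *: std_basis R i) j 0 = if j \in U then a j else 0.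
Proof.
rewrite summxE; under eq_bigr do rewrite !mxE eqxx andbT.
case: ifP => Uj.
  rewrite (bigD1 j) //= eqxx mulr1 big1 ?addr0 // => i /andP[_ /negbTE ij].
  by rewrite eq_sym ij mulr0.
rewrite big1 // => i Ui; case: eqVneq => [ji|_]; last by rewrite mulr0.
by rewrite ji Ui in Uj.
Qed.

Lemma col_std_basis U (w : 'cV[R]_n) :
  (forall i, i \notin U -> w i 0 = 0) ->
  w = \sum_(i in U) w i 0 *: std_basis R i.
Proof.
move=> w0; apply/colP => j; rewrite sum_std_basis.
by case: (boolP (j \in U)) => // /w0.
Qed.

Lemma Sp_openP U (w : 'cV[R]_n) :
  Sp_open R U w <-> [/\ forall i, i \in U -> 0 < w i 0,
    forall i, i \notin U -> w i 0 = 0 & \sum_i w i 0 = 1].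
Proof.
split=> [[a [a_gt0 sum_a ->]]|[w_gt0 w0 sum_w]].
  split=> [i Ui|i /negbTE Ui|]; rewrite ?sum_std_basis ?Ui ?a_gt0 //.
  by under eq_bigr do rewrite sum_std_basis; rewrite -big_mkcond.
exists (fun i => w i 0); split; rewrite -?col_std_basis //.
rewrite -sum_w big_mkcond; apply: eq_bigr => i _.
by case: (boolP (i \in U)) => // /w0 ->.
Qed.

Lemma Sp_closedTP (w : 'cV[R]_n) :
  Sp_closed R [set: 'I_n] w <-> (forall i, 0 <= w i 0) /\ \sum_i w i 0 = 1.
Proof.
split=> [[a [a_ge0 sum_a ->]]|[w_ge0 sum_w]].
  split=> [i|]; first by rewrite sum_std_basis inE a_ge0.
  by rewrite -[RHS]sum_a [RHS]big_mkcond; apply: eq_bigr => i _; rewrite sum_std_basis.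
exists (fun i => w i 0); split=> //; last by apply: col_std_basis => i; rewrite inE.
by rewrite -sum_w; apply: eq_bigl => i; rewrite inE.
Qed.

End InfinitesimalStochastic.

(** * Equality of the two sets, by transposing to row vectors *)

Local Open Scope classical_set_scope.

Theorem theorem1 (R : realType) (n : nat) (G : digraph 'I_n) (hG : rooted G) :
  feasible_set R G =
    \bigcup_(U in [set U : {set 'I_n} | relevant G U]) Sp_open R U.
Proof.
apply/seteqP; split=> w /=.
  move=> [/Sp_closedTP[w_ge0 sum_w] [A [A_G simpleA /(congr1 trmx)]]].
  rewrite trmx_mul trmxK trmx0 => wA.
  exists [set i | 0 < w^T 0 i]%SET.
    apply: support_relevant A_G simpleA _ _ wA => [i|]; first by rewrite mxE.
    rewrite trmx_eq0; apply: contra_eq_neq sum_w => ->.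
    by rewrite big1 ?(eq_sym 0) ?oner_eq0 // => i _; rewrite mxE.
  apply/Sp_openP; split=> // i; rewrite inE mxE //.
  by rewrite lt0r w_ge0 andbT negbK => /eqP.
move=> [U relU /Sp_openP[w_gt0 w0 sum_w]]; split.
  apply/Sp_closedTP; split=> // i.
  by case: (boolP (i \in U)) => [/w_gt0/ltW //|/w0 ->].
have [|||A [A_G simpleA wA]] := @relevant_feasible _ _ G U w^T relU.
- by move=> i Ui; rewrite mxE w_gt0.
- by move=> i Ui; rewrite mxE w0.
- by under eq_bigr do rewrite mxE.
by exists A; split=> //; rewrite -[LHS]trmxK trmx_mul trmxK wA trmx0.
Qed.
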